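(* The critical exponent for $5$-by-$5$ matrices is $m(5)=3$.
   Context: A real $n$-by-$n$ matrix is doubly nonnegative if it is symmetric, positive semidefinite, and entry-wise nonnegative. For positive semidefinite $A=\sum_i\lambda_ix_ix_i^T$ (orthonormal eigenvectors) and $t>0$, $A^t=\sum_i\lambda_i^tx_ix_i^T$. The (conventional) critical exponent $m(n)$ is the least value $m$ such that $A^t$ is doubly nonnegative for all $t\ge m$ and all $n$-by-$n$ doubly nonnegative matrices $A$. *)

(* Defs.v *)
From HB Require Import structures.
From mathcomp Require Import all_boot all_order all_algebra.
From mathcomp Require Import boolp reals exp.
Set Implicit Arguments. Unset Strict Implicit. Unset Printing Implicit Defensive.
Import Order.TTheory GRing.Theory Num.Theory.
Local Open Scope ring_scope.

Section DNN.
Variable R : realType.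

Definition psd (n : nat) (A : 'M[R]_n) : Prop :=
  A^T = A /\ forall x : 'cV[R]_n, 0 <= (x^T *m A *m x) 0 0.

Definition dnn (n : nat) (A : 'M[R]_n) : Prop :=
  A^T = A /\ psd A /\ forall i j, 0 <= A i j.

Definition spectral_decomp (n : nat) (A U : 'M[R]_n) (d : 'rV[R]_n) : Prop :=
  U^T *m U = 1%:M /\ A = U *m diag_mx d *m U^T.

(* A^t := sum_i d_i^t u_i u_i^T for a chosen orthonormal eigen-decomposition
   (well defined, independent of the choice, for PSD A and t > 0). *)
Definition mpow (n : nat) (A : 'M[R]_n) (t : R) : 'M[R]_n :=
  match pselect (exists Ud : 'M[R]_n * 'rV[R]_n, spectral_decomp A Ud.1 Ud.2)
  with
  | left h => let Ud := projT1 (cid h) in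
              Ud.1 *m diag_mx (map_mx (fun x => powR x t) Ud.2) *m Ud.1^T
  | right _ => A
  end.

Definition power_dnn_from (n : nat) (m : R) : Prop :=
  forall (t : R), 0 < t -> m <= t ->
  forall A : 'M[R]_n, dnn A -> dnn (mpow A t).

Definition is_critical_exponent (n : nat) (m : R) : Prop :=
  power_dnn_from n m /\ forall m', power_dnn_from n m' -> m <= m'.

End DNN.

(* Main.v *)
(** Upper bound (Micchelli and Willoughby): let A be symmetric and entrywise
    nonnegative with eigenvalues l_1 <= .. <= l_n.  Then every partial product
    (A - l_1)..(A - l_k) is entrywise nonnegative, by induction on n: a column of
    this product is expressed through the principal submatrix B obtained by
    deleting one index, and interlacing makes the resulting polynomial in B a
    nonnegative combination of the same partial products for B.  In Newton form,
    A^t is the sum over k < n of the divided differences x^t[l_1,..,l_(k+1)] times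
    these products, and the divided differences are values of t(t-1)..(t-k+1)x^(t-k)
    up to positive factors, hence nonnegative as soon as t >= n - 2.  Repeated and
    zero eigenvalues are reached by limits.

    Lower bound: for a tridiagonal matrix with unit off-diagonal entries, only the
    last Newton term contributes to the corner entry of A^t, which is therefore a
    divided difference of order n - 1, negative for n - 3 < t < n - 2. *)
Require Import Defs.
From HB Require Import structures.
From mathcomp Require Import all_boot all_order all_algebra.
From mathcomp Require Import all_fingroup.
From mathcomp Require Import spectral sesquilinear complex ring lra.
From mathcomp Require Import boolp reals normedtype derive exp.
Import Order.TTheory GRing.Theory Num.Theory.
Import numFieldNormedType.Exports.
Set Implicit Arguments. Unset Strict Implicit. Unset Printing Implicit Defensive.
Local Open Scope ring_scope.

(** * Spectral theorem for real symmetric matrices *)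

Section Spectral.
Variable R : realType.

Lemma dot_row_ge0 n (v : 'rV[R]_n) : 0 <= (v *m v^T) 0 0.
Proof. by rewrite mxE sumr_ge0// => k _; rewrite mxE -expr2 sqr_ge0. Qed.

Lemma dot_row_eq0 n (v : 'rV[R]_n) : ((v *m v^T) 0 0 == 0) = (v == 0).
Proof.
apply/idP/eqP => [|->]; last by rewrite mul0mx mxE.
rewrite mxE psumr_eq0 => [/allP v0|k _]; last by rewrite mxE -expr2 sqr_ge0.
apply/rowP => k; have := v0 k; rewrite mem_index_enum !mxE mulf_eq0 orbb.
by move=> /(_ isT)/eqP.
Qed.

Lemma dot_row_gt0 n (v : 'rV[R]_n) : v != 0 -> 0 < (v *m v^T) 0 0.
Proof. by move=> v0; rewrite lt_def dot_row_eq0 v0 dot_row_ge0. Qed.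

(** The reflection along [w = v - e], with [e] the first basis vector, swaps the unit vectors [e]
    and [v]. *)
Lemma householder n (v : 'rV[R]_n.+1) : v *m v^T = 1%:M ->
  exists2 Q : 'M[R]_n.+1, Q *m Q^T = 1%:M & row 0 Q = v.
Proof.
move=> v1; pose e : 'rV[R]_n.+1 := delta_mx 0 0.
have [w wE] : exists w : 'rV[R]_n.+1, w = v - e by exists (v - e).
have [w0|w0] := eqVneq w 0.
  exists 1%:M; first by rewrite trmx1 mulmx1.
  by rewrite row1 (eqP (_ : v == delta_mx 0 0))// -subr_eq0 -/e -wE w0.
pose c := (w *m w^T) 0 0.
have c_gt0 : 0 < c by rewrite dot_row_gt0.
have wwT : w *m w^T = c%:M by apply/matrixP => i j; rewrite !ord1 [RHS]mxE eqxx.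
exists (1%:M - (2 / c) *: (w^T *m w)).
  have -> : (1%:M - (2 / c) *: (w^T *m w))^T = 1%:M - (2 / c) *: (w^T *m w).
    by rewrite linearB/= trmx1 linearZ/= trmx_mul trmxK.
  rewrite mulmxBl mul1mx mulmxBr mulmx1 -scalemxAl -scalemxAr.
  rewrite -mulmxA (mulmxA w) wwT mul_scalar_mx -scalemxAr !scalerA.
  suff -> : 2 / c * (2 / c * c) = 2 / c + 2 / c.
    by rewrite scalerDl opprB addrK subrK.
  by field; rewrite gt_eqF.
have we : (w *m e^T) 0 0 = v 0 0 - 1.
  by rewrite wE mulmxBl trmx_delta mul_delta_mx -colE !mxE eqxx.
have cE : c = - 2 * (v 0 0 - 1).
  rewrite /c {2}wE linearB/= mulmxBr [LHS]mxE [X in _ + X]mxE we wE mulmxBl v1 !mxE.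
  rewrite (bigD1 0)//= !mxE eqxx mul1r big1 => [|k k0]; first by ring.
  by rewrite !mxE (negPf k0) mul0r.
have eQ : e *m w^T = (v 0 0 - 1)%:M.
  apply/matrixP => i j; rewrite !ord1 [RHS]mxE eqxx mulr1n -we.
  by rewrite -[e in LHS]trmxK -trmx_mul mxE.
rewrite rowE -/e mulmxBr mulmx1 -scalemxAr mulmxA eQ mul_scalar_mx scalerA.
have -> : 2 / c * (v 0 0 - 1) = -1.
  have -> : v 0 0 - 1 = - (c / 2) by rewrite cE; field.
  by field; rewrite gt_eqF.
by rewrite scaleN1r opprK wE addrC subrK.
Qed.

(** Over the complex numbers the matrix is Hermitian, so its spectrum is real. *)
Lemma sym_char_poly_root n (A : 'M[R]_n.+1) : A^T = A ->
  exists a : R, root (char_poly A) a.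
Proof.
move=> Asym; pose Ac := map_mx (real_complex R) A.
have Acherm : Ac \is hermsymmx.
  apply: realsym_hermsym.
    by apply/is_hermitianmxP; rewrite scale1r; apply/matrixP => i j; rewrite !mxE -{1}Asym mxE.
  apply/mxOverP => i j; by rewrite mxE complex_real.
have Acreal := hermitian_spectral_diag_real Acherm.
have /hermitian_normalmx/orthomx_spectralP AcE := Acherm.
set P := spectralmx Ac in AcE; set d := spectral_diag Ac in AcE Acreal.
have Pu : P \in unitmx by exact: spectral_unit.
have ev : eigenvalue Ac (d 0 0).
  apply/eigenvalueP; exists (row 0 P).
    rewrite {1}AcE !mulmxA -row_mul mulmxV// row1 -rowE.
    by rewrite row_diag_mx -scalemxAl -rowE.
  apply: contraTneq Pu => r0; rewrite unitmxE unitfE negbK; apply/det0P.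
  exists (delta_mx 0 0); last by rewrite -rowE.
  by apply/eqP => /matrixP/(_ 0 0)/eqP; rewrite !mxE oner_eq0.
rewrite eigenvalue_root_char -map_char_poly in ev.
have /complex_realP[a da] := mxOverP Acreal 0 0.
by exists a; rewrite -(fmorph_root (real_complex R)) /= -da.
Qed.

(** Deflation: in an orthonormal basis starting with an eigenvector, the matrix splits into a 1-by-1
    block and a smaller symmetric block. *)
Lemma sym_spectral_decomp n (A : 'M[R]_n) : A^T = A ->
  exists U d, spectral_decomp A U d.
Proof.
elim: n A => [|n IHn] A Asym.
  by exists 1%:M, 0; split; apply/matrixP => -[].
have [a] := sym_char_poly_root Asym.
rewrite -eigenvalue_root_char => /eigenvalueP[v vA v0].
pose c := (v *m v^T) 0 0.
have c_gt0 : 0 < c by rewrite dot_row_gt0.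
have vvT : v *m v^T = c%:M by apply/matrixP => i j; rewrite !ord1 [RHS]mxE eqxx.
have [Q QQT Q0] : exists2 Q : 'M[R]_n.+1, Q *m Q^T = 1%:M &
    row 0 Q = (Num.sqrt c)^-1 *: v.
  apply: householder.
  rewrite linearZ/= -scalemxAl -scalemxAr vvT scalerA -invfM -expr2.
  by rewrite sqr_sqrtr ?ltW// scale_scalar_mx mulVf ?gt_eqF.
have QTQ := mulmx1C QQT.
have [M QAQ] : exists M : 'M[R]_(1 + n), M = Q *m A *m Q^T by eexists.
have Msym : M^T = M by rewrite QAQ !trmx_mul trmxK Asym mulmxA.
have Mrow : row 0 M = a *: delta_mx 0 0.
  rewrite QAQ !row_mul Q0 -scalemxAl vA scalerA mulrC -scalerA -Q0 -scalemxAl.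
  by rewrite -row_mul QQT row1.
have M0 i : M 0 i = a *+ (i == 0).
  by have /rowP/(_ i) := Mrow; rewrite !mxE eqxx/= mulr_natr eq_sym.
pose B := drsubmx M.
have l0 : lshift n (0 : 'I_1) = (0 : 'I_n.+1) by exact: val_inj.
have ME : M = block_mx a%:M 0 0 B.
  rewrite -[M in LHS]submxK; congr block_mx.
  - apply/matrixP => i j; rewrite !ord1 !mxE.
    by rewrite l0 M0.
  - apply/matrixP => i j; rewrite !ord1 !mxE.
    by rewrite l0 M0.
  - apply/matrixP => i j; rewrite !ord1 -Msym !mxE.
    by rewrite l0 M0.
have Bsym : B^T = B by rewrite /B trmx_drsub Msym.
have [V [d [VV BE]]] := IHn B Bsym.
pose W : 'M[R]_(1 + n) := block_mx 1%:M 0 0 V.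
pose e : 'rV[R]_(1 + n) := row_mx a%:M d.
have WW : W^T *m W = 1%:M.
  rewrite /W tr_block_mx !trmx0 trmx1 mulmx_block !mulmx0 !mul0mx !addr0 !add0r.
  by rewrite VV mulmx1 -scalar_mx_block.
have eE : diag_mx e = block_mx a%:M 0 0 (diag_mx d).
  by rewrite /e diag_mx_row; congr block_mx; apply/matrixP => i j;
    rewrite !ord1 !mxE eqxx.
exists (Q^T *m W), e; split.
  by rewrite trmx_mul trmxK mulmxA -(mulmxA W^T) QQT mulmx1 WW.
rewrite trmx_mul trmxK !mulmxA -(mulmxA _ W) -(mulmxA _ _ W^T).
have -> : W *m diag_mx e *m W^T = M.
  rewrite ME eE /W tr_block_mx !trmx0 trmx1 !mulmx_block.
  rewrite !(mulmx0, mul0mx, addr0, add0r, mulmx1, mul1mx).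
  by rewrite BE.
by rewrite QAQ !mulmxA QTQ mul1mx -mulmxA QTQ mulmx1.
Qed.

Lemma spectral_entry n (f : R -> R) (U : 'M[R]_n) d i j :
  (U *m diag_mx (map_mx f d) *m U^T) i j = \sum_k U i k * U j k * f (d 0 k).
Proof.
rewrite mxE; apply: eq_bigr => k _; rewrite mul_mx_diag !mxE.
by rewrite mulrAC.
Qed.

(** Permuting eigenpairs changes no [f(A)]; the last clause carries results for sorted eigenvalues
    over to the arbitrary decomposition picked by [mpow]. *)
Lemma spectral_decomp_sorted n (A U : 'M[R]_n) d : spectral_decomp A U d ->
  exists V e, [/\ spectral_decomp A V e,
    sorted <=%R [seq e 0 i | i <- enum 'I_n],
    forall i, exists k, e 0 i = d 0 k &
    forall f : R -> R, U *m diag_mx (map_mx f d) *m U^T =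
                       V *m diag_mx (map_mx f e) *m V^T].
Proof.
move=> [UU AE]; pose s := [tuple d 0 i | i < n].
have /tuple_permP[p ps] : perm_eq (sort <=%R s) s by rewrite perm_sort.
pose e := \row_i d 0 (p i).
have fE (f : R -> R) : U *m diag_mx (map_mx f d) *m U^T =
    col_perm p U *m diag_mx (map_mx f e) *m (col_perm p U)^T.
  apply/matrixP => i j; rewrite !spectral_entry (reindex_inj (@perm_inj _ p)).
  by apply: eq_bigr => k _; rewrite !mxE.
exists (col_perm p U), e; split => //.
  split; last by rewrite AE -[d in LHS](map_mx_id (fun=> erefl)) fE map_mx_id.
  apply/matrixP => i j; rewrite mxE.
  have /matrixP/(_ (p i) (p j)) := UU; rewrite !mxE (inj_eq perm_inj) => <-.
  by apply: eq_bigr => k _; rewrite !mxE.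
  have -> : [seq e 0 i | i <- enum 'I_n] = sort <=%R s.
    by rewrite ps; apply: eq_map => i; rewrite mxE tnth_mktuple.
  exact: (sort_sorted le_total).
by move=> i; exists (p i); rewrite mxE.
Qed.

End Spectral.

(** * The Micchelli-Willoughby theorem *)

Section MicchelliWilloughby.
Variable R : realType.

Definition nodes n (d : 'rV[R]_n) : seq R := [seq d 0 i | i <- enum 'I_n].

Lemma size_nodes n (d : 'rV[R]_n) : size (nodes d) = n.
Proof. by rewrite size_map size_enum_ord. Qed.

Lemma nth_nodes n (d : 'rV[R]_n) (i : 'I_n) : (nodes d)`_i = d 0 i.
Proof. by rewrite (nth_map i) ?size_enum_ord// nth_ord_enum. Qed.

Lemma prod_nodes n (d : 'rV[R]_n) (F : R -> {poly R}) :
  \prod_(x <- nodes d) F x = \prod_i F (d 0 i).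
Proof. by rewrite big_map big_enum. Qed.

Lemma sorted_nodes n (d : 'rV[R]_n) (i j : 'I_n) :
  sorted <=%R (nodes d) -> (i <= j)%N -> d 0 i <= d 0 j.
Proof.
move=> sd ij; rewrite -!nth_nodes.
by apply: (sorted_leq_nth le_trans le_refl 0 sd); rewrite // inE size_nodes.
Qed.

Lemma spectral_decompC n (A U : 'M[R]_n) d : spectral_decomp A U d ->
  U *m U^T = 1%:M.
Proof. by case=> /mulmx1C. Qed.

Lemma spectral_decomp_sym n (A U : 'M[R]_n) d : spectral_decomp A U d -> A^T = A.
Proof. by case=> _ ->; rewrite !trmx_mul trmxK tr_diag_mx mulmxA. Qed.

Lemma spectral_decomp_char_poly n (A U : 'M[R]_n) d : spectral_decomp A U d ->
  char_poly A = \prod_(x <- nodes d) ('X - x%:P).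
Proof.
move=> dec; have UUT := spectral_decompC dec; have [_ AE] := dec.
pose V := map_mx polyC U.
have VV : V *m V^T = 1%:M.
  by rewrite map_trmx -map_mxM UUT map_mx1.
have -> : char_poly A = \det ('X%:M - map_mx polyC (diag_mx d)).
  rewrite /char_poly /char_poly_mx AE !map_mxM -map_trmx -/V.
  have -> : 'X%:M - V *m map_mx polyC (diag_mx d) *m V^T =
      V *m ('X%:M - map_mx polyC (diag_mx d)) *m V^T.
    rewrite mulmxBr mulmxBl; congr (_ - _).
    by rewrite scalar_mxC -mulmxA VV mulmx1.
  rewrite !det_mulmx mulrAC -det_mulmx VV det1 mul1r//.
have -> : 'X%:M - map_mx polyC (diag_mx d) = diag_mx (\row_i ('X - (d 0 i)%:P)).
  apply/matrixP => i j; rewrite !mxE; case: eqVneq => // _.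
  by rewrite !mulr0n subrr.
by rewrite det_diag prod_nodes; apply: eq_bigr => i _; rewrite mxE.
Qed.

Lemma spectral_decomp_horner n (A U : 'M[R]_n.+1) d p : spectral_decomp A U d ->
  horner_mx A p = U *m diag_mx (map_mx (horner p) d) *m U^T.
Proof.
move=> dec; have UUT := spectral_decompC dec; have [_ ->] := dec.
have [Uu UT] : U \in unitmx /\ U^T = invmx U.
  have Uu := proj1 (mulmx1_unit UUT); split=> //.
  by rewrite -[LHS](mulKmx Uu) UUT mulmx1.
by rewrite UT horner_mx_uconj// horner_mx_diag.
Qed.

Lemma quad_spectral n (A U : 'M[R]_n) d (x : 'rV[R]_n) : spectral_decomp A U d ->
  (x *m A *m x^T) 0 0 = \sum_i d 0 i * (x *m U) 0 i ^+ 2.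
Proof.
move=> [_ ->]; rewrite !mulmxA -(mulmxA _ _ x^T) -trmx_mul mxE.
apply: eq_bigr => i _; rewrite mul_mx_diag [X in X * _]mxE [X in _ * X]mxE.
by rewrite mulrAC -expr2 mulrC.
Qed.

Lemma dot_spectral n (A U : 'M[R]_n) d (x : 'rV[R]_n) : spectral_decomp A U d ->
  (x *m x^T) 0 0 = \sum_i (x *m U) 0 i ^+ 2.
Proof.
move=> dec; rewrite -[x in x *m _]mulmx1 -(spectral_decompC dec) mulmxA.
rewrite -mulmxA -trmx_mul mxE.
by apply: eq_bigr => i _; rewrite [X in _ * X]mxE.
Qed.

(** Half of Cauchy interlacing: some vector has a Rayleigh quotient that is at least [e_k] for the
    submatrix and at most [d_(k+1)] for [A]. *)
Lemma interlacing n (A U : 'M[R]_n.+1) d j (V : 'M[R]_n) (e : 'rV[R]_n) :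
  spectral_decomp A U d -> spectral_decomp (row' j (col' j A)) V e ->
  sorted <=%R (nodes d) -> sorted <=%R (nodes e) ->
  forall k : 'I_n, e 0 k <= d 0 (lift ord0 k).
Proof.
move=> decA decB sd se k.
(* A zero column makes C singular: y is a nonzero vector orthogonal to the first
   k eigenvectors of B and, padded by 0, to all but the first k + 2 of A. *)
pose C : 'M[R]_n := \matrix_(i, l) if (l < k)%N then V i l else
  if l == k then 0 else U (lift j i) (lift ord0 l).
have [y y0 yC] : exists2 y : 'rV[R]_n, y != 0 & y *m C = 0.
  apply/det0P; rewrite -det_tr; apply/det0P; exists (delta_mx 0 k).
    by apply/eqP => /matrixP/(_ 0 k)/eqP; rewrite !mxE !eqxx oner_eq0.
  by rewrite -rowE; apply/rowP => i; rewrite !mxE ltnn eqxx.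
pose x : 'rV[R]_n.+1 := \row_i oapp (y 0) 0 (unlift j i).
have xj : x 0 j = 0 by rewrite mxE unlift_none.
have xl i : x 0 (lift j i) = y 0 i by rewrite mxE liftK.
have xU l : (x *m U) 0 l = \sum_i y 0 i * U (lift j i) l.
  rewrite mxE (bigD1_ord j)//= xj mul0r add0r.
  by apply: eq_bigr => i _; rewrite xl.
have yV (l : 'I_n) : (l < k)%N -> (y *m V) 0 l = 0.
  move=> lk; have /rowP/(_ l) := yC; rewrite !mxE => yC0; rewrite -[RHS]yC0.
  by apply: eq_bigr => i _; rewrite mxE lk.
have xU0 (l : 'I_n) : (k < l)%N -> (x *m U) 0 (lift ord0 l) = 0.
  move=> kl; rewrite xU; have /rowP/(_ l) := yC; rewrite !mxE => yC0; rewrite -[RHS]yC0.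
  by apply: eq_bigr => i _; rewrite mxE ltnNge ltnW//= gt_eqF.
have xx : (x *m x^T) 0 0 = (y *m y^T) 0 0.
  rewrite !mxE (bigD1_ord j)//= xj mul0r add0r.
  by apply: eq_bigr => i _; rewrite !mxE liftK.
have xAx : (x *m A *m x^T) 0 0 = (y *m row' j (col' j A) *m y^T) 0 0.
  rewrite !mxE (bigD1_ord j)//= [X in _ * X + _]mxE xj mulr0 add0r.
  apply: eq_bigr => i _; rewrite [X in _ * X]mxE xl [X in _ = _ * X]mxE.
  congr (_ * _); rewrite !mxE (bigD1_ord j)//= xj mul0r add0r.
  by apply: eq_bigr => l _; rewrite xl !mxE.
have yy_gt0 := dot_row_gt0 y0.
rewrite -(ler_pM2r yy_gt0) (@le_trans _ _ ((x *m A *m x^T) 0 0))//.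
  rewrite xAx (quad_spectral _ decB) (dot_spectral _ decB) mulr_sumr.
  apply: ler_sum => l _; have [lk|kl] := ltnP l k.
    by rewrite yV// expr0n/= !mulr0.
  by rewrite ler_wpM2r ?sqr_ge0// sorted_nodes.
rewrite -xx (quad_spectral _ decA) (dot_spectral _ decA) mulr_sumr.
apply: ler_sum => l _; have [m ->|->] := unliftP ord0 l; last first.
  by rewrite ler_wpM2r ?sqr_ge0// sorted_nodes.
have [km|mk] := ltnP k m; first by rewrite xU0// expr0n/= !mulr0.
by rewrite ler_wpM2r ?sqr_ge0// sorted_nodes// !lift0 ltnS.
Qed.

(** * Nonnegative matrices and Newton cones *)

Definition nnmx m n (M : 'M[R]_(m, n)) := forall i j, 0 <= M i j.

Lemma nnmxM m n p (M : 'M[R]_(m, n)) (N : 'M[R]_(n, p)) :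
  nnmx M -> nnmx N -> nnmx (M *m N).
Proof.
by move=> M0 N0 i j; rewrite mxE sumr_ge0// => k _; rewrite mulr_ge0.
Qed.

(* [ncone [:: x_0; ..; x_k] p]: p is a nonnegative combination of the Newton
   polynomials (X - x_0)...(X - x_(i-1)) for i <= k, in Horner form; the value
   of the last node x_k is irrelevant. *)
Inductive ncone : seq R -> {poly R} -> Prop :=
| ncone_nil : ncone [::] 0
| ncone_cons x s c p of 0 <= c & ncone s p :
    ncone (x :: s) (c%:P + ('X - x%:P) * p).

Lemma ncone_prod s x : ncone (rcons s x) (\prod_(y <- s) ('X - y%:P)).
Proof.
elim: s => [|y s IHs] /=.
  rewrite big_nil -[X in ncone _ X]addr0 -(mulr0 ('X - x%:P)).
  exact: ncone_cons ler01 ncone_nil.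
by rewrite big_cons -[X in ncone _ X]add0r; apply: ncone_cons.
Qed.

Lemma ncone_consE x s p : ncone (x :: s) p ->
  exists c q, [/\ 0 <= c, ncone s q & p = c%:P + ('X - x%:P) * q].
Proof.
move E : (x :: s) => t H; case: H E => // y u c q c0 qu [-> ->].
by exists c, q.
Qed.

(** If [q = b + (X - a) r], then [c + (X - y) q = (c + (a - y) b) + (X - a) (b + (X - y) r)], where
    [a - y >= 0]. The division uses up the last node. *)
Lemma ncone_div s x p a : ncone (rcons s x) p -> all (<= a) s ->
  exists c q, [/\ 0 <= c, ncone s q & p = c%:P + ('X - a%:P) * q].
Proof.
elim: s p => [|y s IHs] p /= /ncone_consE[c [q [c0 qs ->]]].
  move=> _; exists c, 0; split => //; first exact: ncone_nil.
  move E : [::] qs => t H; case: H E => // _.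
  by rewrite !mulr0.
move=> /andP[ya sa]; have [b [r [b0 rs ->]]] := IHs _ qs sa.
exists (c + (a - y) * b), (b%:P + ('X - y%:P) * r); split.
- by rewrite addr_ge0// mulr_ge0// subr_ge0.
- exact: ncone_cons.
- by rewrite polyCD polyCM polyCB; ring.
Qed.

(** The factor [M] varies in the induction and absorbs the [B - x] peeled off the Horner form. *)
Lemma ncone_horner n m (B : 'M[R]_n.+1) (M : 'M[R]_(n.+1, m)) s p : ncone s p ->
  (forall k, nnmx (horner_mx B (\prod_(y <- take k s) ('X - y%:P)) *m M)) ->
  nnmx (horner_mx B p *m M).
Proof.
move=> ps; elim: ps M => [|x {}s c {}p c0 _ IHp] M Ms.
  by move=> i j; rewrite rmorph0 mul0mx mxE.
have M0 : nnmx M by have := Ms 0%N; rewrite take0 big_nil rmorph1 mul1mx.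
have pM : nnmx (horner_mx B p *m (horner_mx B ('X - x%:P) *m M)).
  apply: IHp => k; have := Ms k.+1; rewrite /= big_cons mulrC rmorphM/=.
  by rewrite mulmxA.
move=> i j; rewrite rmorphD/= rmorphM/= horner_mx_C mulmxDl mul_scalar_mx.
rewrite [_ * _](comm_horner_mx2 B) -mulmxA 2!mxE addr_ge0//.
exact: mulr_ge0.
Qed.

(** * One column of a product of shifts of [A], through a principal submatrix *)

Section Column.
Variables (n : nat) (A : 'M[R]_n.+2) (j : 'I_n.+2).
Let B : 'M[R]_n.+1 := row' j (col' j A).
Let b : 'cV[R]_n.+1 := \col_i A (lift j i) j.
Let P (l : seq R) : 'M[R]_n.+2 := horner_mx A (\prod_(y <- l) ('X - y%:P)).

(* Column j of p_l(A) = prod_(y <- l) (A - y) has diagonal entry P l j j and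
   off-diagonal part (colpoly l)(B) b. *)
Fixpoint colpoly (l : seq R) : {poly R} :=
  if l is x :: l' then (P l' j j)%:P + ('X - x%:P) * colpoly l' else 0.

Let PS x l : P (x :: l) = A *m P l - x *: P l.
Proof.
rewrite /P big_cons rmorphM/= rmorphB/= horner_mx_X horner_mx_C.
by rewrite [LHS]mulmxBl mul_scalar_mx.
Qed.

(** The off-diagonal part of column [j] of [A N] is [B] times that of [N], plus [N j j] times
    [b]. *)
Lemma colpoly_col l i : P l (lift j i) j = (horner_mx B (colpoly l) *m b) i 0.
Proof.
elim: l i => [|x l IHl] i.
  rewrite /P big_nil rmorph1 /= rmorph0 mul0mx !mxE.
  by rewrite eq_sym (negPf (neq_lift _ _)).
rewrite PS /= rmorphD/= rmorphM/= rmorphB/= horner_mx_X !horner_mx_C.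
rewrite mulmxDl mul_scalar_mx -[_ * _]/(_ *m _) -mulmxA mulmxBl mul_scalar_mx.
rewrite !mxE (bigD1_ord j)//= -addrA mulrC; congr (_ + _); congr (_ - _ * _).
  by apply: eq_bigr => k _; rewrite IHl !mxE.
by rewrite IHl mxE.
Qed.

(* T l is the divided difference (p_l(X) - p_l(A)) / (X - A); when p_l is the
   characteristic polynomial it is the adjugate of X - A. *)
Let T := fix T (l : seq R) : 'M[{poly R}]_n.+2 :=
  if l is x :: l' then map_mx polyC (P l') + ('X - x%:P) *: T l' else 0.

Let TE l : char_poly_mx A *m T l =
  (\prod_(y <- l) ('X - y%:P))%:M - map_mx polyC (P l).
Proof.
elim: l => [|x l IHl].
  have -> : P [::] = 1%:M by rewrite /P big_nil rmorph1.
  by rewrite /= mulmx0 big_nil map_mx1 subrr.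
rewrite /= mulmxDr -scalemxAr IHl big_cons PS /char_poly_mx mulmxBl.
rewrite map_mxB map_mxZ map_mxM mul_scalar_mx scalerBr scale_scalar_mx.
by rewrite scalerBl !opprB addrCA; congr (_ + _); rewrite addrC addrA subrK.
Qed.

(** [T l j j] obeys the recursion of [colpoly]. By Cayley-Hamilton, [T l] is the adjugate of
    [X - A], whose entry at [(j, j)] is the characteristic polynomial of [B]. *)
Lemma colpoly_char_poly l : char_poly A = \prod_(y <- l) ('X - y%:P) ->
  colpoly l = char_poly B.
Proof.
move=> Al; have Tj k : T k j j = colpoly k.
  by elim: k => [|x k IHk] /=; rewrite !mxE// IHk.
have := TE l; rewrite -Al [P l]/P -Al Cayley_Hamilton map_mx0 subr0.
move=> /(congr1 (mulmx (\adj (char_poly_mx A)))).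
rewrite mulmxA mul_adj_mx -/(char_poly A) mul_scalar_mx mul_mx_scalar.
move=> /(scalemx_inj (monic_neq0 (char_poly_monic A)))/matrixP/(_ j j).
rewrite Tj => ->; rewrite mxE /cofactor -signr_odd oddD addbb mul1r.
congr (\det _); apply/matrixP => i k; rewrite !mxE.
by rewrite (inj_eq lift_inj).
Qed.

End Column.

(* Starting from the characteristic polynomial of B and dividing successively by
   X minus the largest, second largest, ... eigenvalue of A stays inside the
   Newton cone of B, because of interlacing. *)
Lemma colpoly_ncone n (A U : 'M[R]_n.+2) d j (V : 'M[R]_n.+1) (e : 'rV[R]_n.+1) :
  spectral_decomp A U d -> spectral_decomp (row' j (col' j A)) V e ->
  sorted <=%R (nodes d) -> sorted <=%R (nodes e) ->
  forall k, (k < n.+2)%N ->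
  ncone (take k (nodes e)) (colpoly A j (rev (take k (nodes d)))) /\
  0 <= horner_mx A (\prod_(y <- take k (nodes d)) ('X - y%:P)) j j.
Proof.
move=> decA decB sd se.
(* A dummy last node: the full product for [B] lies in a cone with [n + 2] nodes. *)
pose E := rcons (nodes e) 0.
have EE k : (k < n.+2)%N -> take k E = take k (nodes e).
  by move=> kn; rewrite /E -cats1 takel_cat// size_nodes -ltnS.
have step k : (k < n.+2)%N ->
    ncone (take k.+1 E) (colpoly A j (rev (take k.+1 (nodes d)))) ->
    ncone (take k (nodes e)) (colpoly A j (rev (take k (nodes d)))) /\
    0 <= horner_mx A (\prod_(y <- take k (nodes d)) ('X - y%:P)) j j.
  move=> kn; rewrite (take_nth 0) ?size_rcons ?size_nodes// EE//.
  rewrite (take_nth 0) ?size_nodes// rev_rcons /=.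
  set a := (nodes d)`_k => /ncone_div-/(_ a)[].
    apply/(all_nthP 0) => i; rewrite size_take size_nodes => ilt.
    have [ik ie] : (i < k)%N /\ (i < n.+1)%N.
      move: ilt; case: (ltnP k n.+1) => [kn' ik|nk ie]; split=> //.
        exact: ltn_trans kn'.
      exact: leq_trans nk.
    rewrite nth_take// (nth_nodes e (Ordinal ie)).
    apply: le_trans (interlacing decA decB sd se (Ordinal ie)) _.
    by rewrite /a (nth_nodes d (Ordinal kn)) sorted_nodes// lift0.
  move=> c [q [c0 qe]].
  have -> : \prod_(y <- rev (take k (nodes d))) ('X - y%:P) =
      \prod_(y <- take k (nodes d)) ('X - y%:P).
    by apply: perm_big; rewrite perm_rev.
  set G := colpoly _ _ _; set u := horner_mx _ _ _ _ => eq.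
  (* Evaluation at [a] identifies the nonnegative constant with the diagonal entry; [X - a] is then
     cancelled. *)
  have uc : u = c.
    have := congr1 (horner^~ a) eq.
    by rewrite !hornerE subrr !mul0r !addr0.
  move: eq; rewrite uc => /addrI/mulfI -> //.
  by rewrite polyXsubC_eq0.
move=> k kn; apply: (step) => //; rewrite ltnS in kn.
(* Descending induction on [k], starting from the full product. *)
have -> : k = (n.+1 - (n.+1 - k))%N by rewrite subKn.
elim: (n.+1 - k)%N => [|i IHi].
  rewrite subn0 !take_oversize ?size_rcons ?size_nodes//.
  rewrite (@colpoly_char_poly _ A j); last first.
    rewrite (spectral_decomp_char_poly decA).
    by apply: perm_big; rewrite perm_sym perm_rev.
  rewrite (spectral_decomp_char_poly decB); exact: ncone_prod.
have [ni|ni] := leqP n.+1 i.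
  have -> : (n.+1 - i.+1 = n.+1 - i)%N; last exact: IHi.
  by rewrite (eqP ni) subnS (eqP ni).
move: IHi; rewrite subnSK// => /step[]; first by rewrite ltnS leq_subr.
by rewrite EE// ltnS leq_subr.
Qed.

Theorem micchelli_willoughby n (A U : 'M[R]_n.+1) d : spectral_decomp A U d ->
  sorted <=%R (nodes d) -> nnmx A ->
  forall k, nnmx (horner_mx A (\prod_(y <- take k (nodes d)) ('X - y%:P))).
Proof.
elim: n A U d => [|n IHn] A U d decA sd A0 k.
  have [k0|k0] := posnP k.
    by rewrite k0 take0 big_nil rmorph1 => i j; rewrite mxE ler0n.
  rewrite take_oversize ?size_nodes// -(spectral_decomp_char_poly decA).
  by rewrite Cayley_Hamilton => i j; rewrite mxE.
have [kn|nk] := ltnP k n.+2; last first.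
  rewrite take_oversize ?size_nodes// -(spectral_decomp_char_poly decA).
  by rewrite Cayley_Hamilton => i j; rewrite mxE.
move=> i j; pose B : 'M[R]_n.+1 := row' j (col' j A).
have Bsym : B^T = B.
  by apply/matrixP => x y; rewrite !mxE -[in LHS](spectral_decomp_sym decA) mxE.
have [V0 [e0 decB0]] := sym_spectral_decomp Bsym.
have [V [e [decB se _ _]]] := spectral_decomp_sorted decB0.
have [coneG djj] := colpoly_ncone decA decB sd se kn.
(* Diagonal entries are settled by [djj]. Off the diagonal, an element of the Newton cone of [B]
   acts on a nonnegative column. *)
have [l ->|->//] := unliftP j i.
have <- : \prod_(y <- rev (take k (nodes d))) ('X - y%:P) =
    \prod_(y <- take k (nodes d)) ('X - y%:P).
  by apply: perm_big; rewrite perm_rev.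
rewrite colpoly_col; apply: (ncone_horner coneG) => m.
apply: nnmxM => [|x y]; last by rewrite mxE.
rewrite -take_min; apply: (IHn _ V) => // x y; by rewrite !mxE.
Qed.

End MicchelliWilloughby.

(** * Divided differences *)

Section DividedDifferences.
Variable R : realType.
Implicit Types (f : R -> R) (s c : seq R).

(* The divided differences f[x_0], f[x_0,x_1], f[x_0,x_1,x_2], .. *)
Fixpoint dds f s : seq R :=
  if s is x :: s' then f x :: dds (fun y => (f y - f x) / (y - x)) s' else [::].

Fixpoint newp s c : {poly R} :=
  match s, c with
  | x :: s', a :: c' => a%:P + ('X - x%:P) * newp s' c'
  | _, _ => 0
  end.

Lemma size_dds f s : size (dds f s) = size s.
Proof. by elim: s f => //= x s IHs f; rewrite IHs. Qed.

Lemma take_dds f s k : take k (dds f s) = dds f (take k s).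
Proof. by elim: s f k => [|x s IHs] f [|k] //=; rewrite IHs. Qed.

Lemma newp_dds f s y : uniq s -> y \in s -> (newp s (dds f s)).[y] = f y.
Proof.
elim: s f => //= x s IHs f /andP[xs us]; rewrite inE !hornerE => /predU1P[->|ys].
  by rewrite subrr mul0r addr0.
rewrite IHs//= mulrC divfK; first by rewrite addrC subrK.
by rewrite subr_eq0; apply: contraNneq xs => <-.
Qed.

Lemma size_newp s c : (size (newp s c) <= size s)%N.
Proof.
elim: s c => [|x s IHs] [|a c]; rewrite ?size_poly0//=.
rewrite (leq_trans (size_polyD _ _))// geq_max (leq_trans (size_polyC_leq1 _))//=.
by rewrite (leq_trans (size_polyMleq _ _))// size_XsubC /= ltnS.
Qed.

Lemma coef_newp k s c : size s = k.+1 -> size c = k.+1 ->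
  (newp s c)`_k = last 0 c.
Proof.
elim: k s c => [|k IHk] [|x s] [|a c]//= [ss] [sc].
  by case: s c ss sc => [|//] [|//] _ _ /=; rewrite mulr0 addr0 coefC.
rewrite coefD coefC add0r mulrBl coefB coefXM /= coefCM IHk//.
rewrite [X in _ * X]nth_default ?mulr0 ?subr0; last by rewrite -ss size_newp.
by case: c sc => [|b c].
Qed.

Lemma newp_ncone s c : size c = size s -> all (>= 0) c -> ncone s (newp s c).
Proof.
elim: s c => [|x s IHs] [|a c]//=; first by move=> _ _; exact: ncone_nil.
by move=> [sc] /andP[a0 c0]; apply: ncone_cons => //; exact: IHs.
Qed.

(** Rolle between consecutive zeros; the location of the new zeros is recorded so that the step can
    be iterated. *)
Lemma rolle_path (f g : R -> R) (x : R) s :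
  (forall y : R, 0 < y -> is_derive y 1 f (g y)) -> 0 < x -> path <%R x s ->
  f x = 0 -> all (fun y => f y == 0) s ->
  exists s', [/\ size s' = size s, path <%R x s', all (<= last x s) s' &
    all (fun y => g y == 0) s'].
Proof.
move=> df; elim: s x => [|y s IHs] x x0 /=; first by exists [::].
move=> /andP[xy ys] fx /andP[/eqP fy fs].
have y0 := lt_trans x0 xy.
have [s' [ss' ys' ls' gs']] := IHs y y0 ys fy fs.
have [z zxy [dz z0]] : exists2 z, z \in `]x, y[ & is_derive z 1 f 0.
  apply: Rolle => //; last by rewrite fx fy.
    move=> z; rewrite in_itv/= => /andP[xz _].
    by have [] := df z (lt_trans x0 xz).
  apply: derivable_within_continuous => z; rewrite in_itv/= => /andP[xz _].
  by have [] := df z (lt_le_trans x0 xz).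
have /andP[xz zy] : x < z < y by move: zxy; rewrite in_itv.
have gz : g z = 0.
  by have [_ <-] := df z (lt_trans x0 xz).
have yl : y <= last y s.
  elim: (s) {IHs fs ss' ls'} (y) ys => //= w u IHu v /andP[vw wu].
  by rewrite (le_trans (ltW vw))// IHu.
exists (z :: s'); split => /=.
- by rewrite ss'.
- rewrite xz/=; case: (s') ys' => //= w u /andP[yw ->].
  by rewrite (lt_trans zy yw).
- by rewrite (le_trans (ltW zy) yl).
- by rewrite gz eqxx.
Qed.

Lemma rolle_iter k (F : nat -> R -> R) (x : R) s :
  (forall j (y : R), 0 < y -> is_derive y 1 (F j) (F j.+1 y)) -> 0 < x ->
  path <%R x s -> size s = k ->
  F 0 x = 0 -> all (fun y => F 0 y == 0) s ->
  exists z, [/\ x <= z, z <= last x s & F k z = 0].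
Proof.
elim: k F x s => [|k IHk] F x s dF x0 xs ss Fx Fs.
  by exists x; case: s ss {xs Fs}.
have [[|y s'] [ss' xs' ls' gs']] := rolle_path (dF 0%N) x0 xs Fx Fs.
  by move: ss'; rewrite ss.
have /andP[xy ys'] := xs'; have /andP[/eqP gy gs] := gs'.
have [z [yz zl Fz]] := IHk (fun j => F j.+1) y s' (fun j => dF j.+1)
  (lt_trans x0 xy) ys' (succn_inj (etrans ss' ss)) gy gs.
exists z; split => //; first exact: le_trans (ltW xy) yz.
by rewrite (le_trans zl)//; apply: (allP ls'); rewrite mem_last.
Qed.

(** [F 0] minus its Newton interpolant has [k + 1] zeros, so its [k]-th derivative has one; that of
    the interpolant is the constant [k!] times the leading coefficient. *)
Lemma dds_mvt k (F : nat -> R -> R) (x : R) s :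
  (forall j (y : R), 0 < y -> is_derive y 1 (F j) (F j.+1 y)) -> 0 < x ->
  path <%R x s -> size s = k ->
  exists z, [/\ x <= z, z <= last x s &
    last 0 (dds (F 0) (x :: s)) * k`!%:R = F k z].
Proof.
move=> dF x0 xs ss; set c := dds _ _; pose p := newp (x :: s) c.
have us : uniq (x :: s) by exact: (sorted_uniq lt_trans ltxx).
pose G j y := F j y - (p^`(j)).[y].
have [|||z [xz zl Gz]] := @rolle_iter k G x s _ x0 xs ss.
- move=> j y y0; rewrite /G derivnS.
  by have := dF j y y0 => ?; exact: is_deriveB.
- by rewrite /G derivn0 newp_dds ?mem_head// subrr.
- apply/allP => y ys; rewrite /G derivn0 newp_dds ?subrr//.
  by rewrite inE ys orbT.
exists z; split => //; move/eqP: Gz; rewrite subr_eq0 => /eqP ->.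
have sp : (size p <= k.+1)%N by rewrite (leq_trans (size_newp _ _))//= ss.
have -> : p^`(k) = (p`_k *+ k`!)%:P.
  rewrite [LHS]size1_polyC.
    by rewrite coef_derivn addn0 ffactnn.
  apply/leq_sizeP => j j0; rewrite coef_derivn nth_default ?mul0rn//.
  by rewrite (leq_trans sp)// -addn1 leq_add2l.
have sc : size c = k.+1 by rewrite size_dds /= ss.
have sxs : size (x :: s) = k.+1 by rewrite /= ss.
by rewrite hornerC mulr_natr (coef_newp sxs sc).
Qed.

End DividedDifferences.

(** * Approximation from the Newton cone at possibly repeated nodes *)

Section NewtonApprox.
Variable R : realType.
Implicit Types (f : R -> R) (s c : seq R).

(** [K] depends only on [C], [M] and [n], so it is fixed before the perturbation size [e]. *)
Lemma newp_lipschitz (C M : R) n : 0 <= C -> 0 <= M ->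
  exists2 K, 0 <= K & forall s s' c (z z' e : R),
    size s = n -> size s' = n -> size c = n ->
    (forall i, (i < n)%N -> [/\ `|c`_i| <= C, `|z - s`_i| <= M,
        `|z' - s'`_i| <= M & `|s`_i - s'`_i| <= e]) ->
    0 <= e -> `|z - z'| <= e ->
    [/\ `|(newp s c).[z]| <= K, `|(newp s' c).[z']| <= K &
        `|(newp s c).[z] - (newp s' c).[z']| <= K * e].
Proof.
move=> C0 M0; elim: n => [|n [K K0 IHn]].
  exists 0 => // -[|//] [|//] [|//] z z' e _ _ _ _ e0 _ /=.
  by rewrite !horner0 subrr !normr0 mul0r.
exists (C + M * K + 2 * K).
  by rewrite !addr_ge0// mulr_ge0.
move=> [|x s] [|x' s'] [|a c]//= z z' e [ss] [ss'] [sc] H e0 ze.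
have [||||||k1 k2 k3] := IHn s s' c z z' e => //.
  by move=> i ni; exact: (H i.+1).
have [/= ha hx hx' hxx] := H 0%N isT.
rewrite !hornerE.
set N := (newp s c).[z] in k1 k3 *; set N' := (newp s' c).[z'] in k2 k3 *.
have bnd u v : `|u| <= M -> `|v| <= K -> `|a + u * v| <= C + M * K + 2 * K.
  move=> uM vK; rewrite (le_trans (ler_normD _ _))//.
  rewrite (@le_trans _ _ (C + M * K))//; last by rewrite lerDl mulr_ge0.
  by rewrite lerD// normrM ler_pM.
split; [exact: bnd|exact: bnd|].
have -> : a + (z - x) * N - (a + (z' - x') * N') =
   (z - x) * (N - N') + ((z - z') - (x - x')) * N' by ring.
rewrite (le_trans (ler_normD _ _))// !normrM.
rewrite (@le_trans _ _ (M * (K * e) + (e + e) * K))//.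
  apply: lerD; first exact: ler_pM.
  by apply: ler_pM => //; rewrite (le_trans (ler_normB _ _))// lerD.
have -> : (C + M * K + 2 * K) * e = C * e + (M * (K * e) + (e + e) * K) by ring.
by rewrite lerDr mulr_ge0.
Qed.

Section Approx.
Variables (n : nat) (F : nat -> R -> R) (a : R) (x : seq R).
Hypothesis dF : forall j (y : R), 0 < y -> is_derive y 1 (F j) (F j.+1 y).
Hypothesis F0 : forall k (y : R), (k <= n)%N -> 0 < y -> 0 <= F k y.
Hypothesis a0 : 0 < a.
Hypothesis bF : forall b, exists C, forall k y, (k <= n.+1)%N ->
  a <= y -> y <= b -> `|F k y| <= C.
Hypothesis size_x : size x = n.+1.
Hypothesis sorted_x : sorted <=%R x.
Hypothesis ax : all (>= a) x.

(* The nodes are moved apart by multiples of a small [eps]; the divided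
   differences at the new nodes are nonnegative and bounded independently of
   [eps], so they can be used as coefficients for the original nodes. *)
Lemma newton_approx (eta : R) : 0 < eta ->
  exists2 p, ncone x p & forall y, y \in x -> `|p.[y] - F 0 y| <= eta.
Proof.
move=> eta0.
have le_x i j : (i <= j)%N -> (j < n.+1)%N -> x`_i <= x`_j.
  move=> ij jn; apply: (sorted_leq_nth le_trans le_refl 0 sorted_x) => //.
    by rewrite inE size_x (leq_ltn_trans ij).
  by rewrite inE size_x.
have a_x i : (i < n.+1)%N -> a <= x`_i.
  by move=> ni; apply: (allP ax); rewrite mem_nth// size_x.
(* Shifts are at most [n + 1] since [eps <= 1], so old and new nodes lie in [[a, b]]. *)
pose b := x`_n + n.+1%:R.
have [C0 bC0] := bF b.
pose C := Num.max C0 0.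
have C_ge0 : 0 <= C by rewrite le_max lexx orbT.
have bC k y : (k <= n.+1)%N -> a <= y -> y <= b -> `|F k y| <= C.
  by move=> kn ay yb; rewrite le_max bC0.
have ab : a <= b by rewrite (le_trans (a_x n _))// lerDl.
have ba : 0 <= b - a by rewrite subr_ge0.
have [K K0 lipK] := newp_lipschitz n.+1 C_ge0 ba.
(* The total error is at most [(K + C) (n + 1) eps]; adding 1 makes [D] positive. *)
pose D := (K + C) * n.+1%:R + 1.
have D_gt0 : 0 < D by rewrite ltr_wpDl// mulr_ge0// addr_ge0.
pose eps := Num.min 1 (eta / D).
have eps0 : 0 < eps by rewrite lt_min ltr01 divr_gt0.
have eps1 : eps <= 1 by rewrite ge_min lexx.
have [y size_y yE] : exists2 y : seq R, size y = n.+1 &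
    forall i, (i < n.+1)%N -> y`_i = x`_i + i%:R * eps.
  exists (mkseq (fun i => x`_i + i%:R * eps) n.+1); first by rewrite size_mkseq.
  by move=> i ni; rewrite nth_mkseq.
have shift i : (i < n.+1)%N -> 0 <= i%:R * eps <= n.+1%:R * eps.
  move=> ni; rewrite ler_pM2r// ler_nat ltnW// andbT.
  by rewrite mulr_ge0// ltW.
have y_ab i : (i < n.+1)%N -> a <= y`_i <= b.
  move=> ni; rewrite yE//; have /andP[s0 s1] := shift i ni.
  rewrite (le_trans (a_x i ni)) ?lerDl//= lerD ?le_x//.
  by rewrite (le_trans s1)// -[leRHS]mulr1 ler_pM2l// ltr0n.
have x_ab i : (i < n.+1)%N -> a <= x`_i <= b.
  move=> ni; rewrite a_x//= (le_trans (le_x i n _ _))//.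
  by rewrite lerDl.
have sorted_y : sorted <%R y.
  apply/(sortedP 0) => i; rewrite size_y => ni.
  rewrite !yE ?(ltnW ni)// ler_ltD ?le_x// ltr_pM2r// ltr_nat ltnSn//.
pose c := dds (F 0) y.
have size_c : size c = n.+1 by rewrite size_dds.
(* [c_i] involves only the first [i + 1] nodes, so the mean value theorem applies to them. *)
have cE i : (i < n.+1)%N -> exists2 z, a <= z <= b & c`_i * i`!%:R = F i z.
  move=> ni.
  have : sorted <%R (take i.+1 y) by rewrite take_sorted.
  have st : size (take i.+1 y) = i.+1 by rewrite size_takel// size_y.
  have -> : c`_i = last 0 (dds (F 0) (take i.+1 y)).
    by rewrite -take_dds (take_nth 0) ?last_rcons// size_c.
  have := nth_take (i := 0) 0 (ltn0Sn i) y.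
  have := nth_take (i := i) 0 (ltnSn i) y.
  case: (take i.+1 y) st => [//|w s] /= [ss].
  have -> : nth 0 (w :: s) i = last w s.
    by rewrite -[last w s]/(last 0 (w :: s)) -nth_last /= ss.
  move=> lE wE ws.
  have /andP[aw wb] := y_ab 0%N isT; rewrite -wE in aw wb.
  have /andP[al lb] := y_ab i ni; rewrite -lE in al lb.
  have [z [wz zl Fz]] := dds_mvt dF (lt_le_trans a0 aw) ws ss.
  by exists z => //; rewrite (le_trans aw)// (le_trans zl).
have c_ge0 i : (i < n.+1)%N -> 0 <= c`_i.
  move=> ni; have [z /andP[az _] cF] := cE i ni.
  rewrite -(pmulr_lge0 _ (_ : 0 < i`!%:R)) ?ltr0n ?fact_gt0// cF F0//.
  exact: lt_le_trans az.
have c_leC i : (i < n.+1)%N -> `|c`_i| <= C.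
  move=> ni; have [z /andP[az zb] cF] := cE i ni.
  rewrite (le_trans _ (bC i z (ltnW ni) az zb))// -cF normrM ler_peMr//.
  by rewrite ger0_norm ?ler0n// ler1n fact_gt0.
exists (newp x c).
  apply: newp_ncone; first by rewrite size_c size_x.
  by apply/(all_nthP 0) => i; rewrite size_c; exact: c_ge0.
move=> w /(nthP 0)[l]; rewrite size_x => ln <- {w}.
have /andP[s0 s1] := shift l ln.
(* Two comparisons: [newp x c] at [x_l] with [newp y c] at [y_l], then [F 0] at [y_l] with [F 0] at
   [x_l]. *)
have yy : (newp y c).[y`_l] = F 0 y`_l.
  by rewrite newp_dds ?mem_nth ?size_y// (sorted_uniq lt_trans ltxx).
have dist i j : (i < n.+1)%N -> (j < n.+1)%N -> forall u : seq R,
    (forall i, (i < n.+1)%N -> a <= u`_i <= b) -> `|u`_i - u`_j| <= b - a.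
  move=> ni nj u uab; have /andP[? ?] := uab i ni; have /andP[? ?] := uab j nj.
  by rewrite ler_norml; apply/andP; split; lra.
have sh i : (i < n.+1)%N -> `|x`_i - y`_i| <= n.+1%:R * eps.
  move=> ni; have /andP[? ?] := shift i ni.
  by rewrite yE// opprD addNKr normrN ger0_norm.
have e_ge0 : 0 <= n.+1%:R * eps by rewrite mulr_ge0// ltW.
have [||_ _] := lipK x y c x`_l y`_l (n.+1%:R * eps) size_x size_y size_c _ e_ge0.
- move=> i ni; split; [exact: c_leC|exact: dist|exact: dist|exact: sh].
- exact: sh.
rewrite yy => lip1.
have lip2 : `|F 0 y`_l - F 0 x`_l| <= C * (n.+1%:R * eps).
  have [l0|l0] := posnP l.
    by rewrite yE// l0 mul0r addr0 subrr normr0 mulr_ge0.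
  have xy : x`_l < y`_l by rewrite yE// ltrDl mulr_gt0// ltr0n.
  have /andP[al _] := x_ab l ln; have /andP[_ lb] := y_ab l ln.
  have [|z [xz zy]] := @dds_mvt _ 1 F x`_l [:: y`_l] dF (lt_le_trans a0 al) _ erefl.
    by rewrite /= xy.
  rewrite /= mulr1 => dE.
  have -> : F 0 y`_l - F 0 x`_l = F 1 z * (y`_l - x`_l).
    by rewrite -dE divfK// subr_eq0 gt_eqF.
  rewrite normrM ler_pM//; last by rewrite distrC sh.
  by apply: bC; rewrite ?(le_trans al)// (le_trans zy).
have -> : (newp x c).[x`_l] - F 0 x`_l =
  ((newp x c).[x`_l] - F 0 y`_l) + (F 0 y`_l - F 0 x`_l) by rewrite addrA subrK.
rewrite (le_trans (ler_normD _ _))// (le_trans (lerD lip1 lip2))//.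
rewrite -mulrDl mulrA.
rewrite (@le_trans _ _ (D * eps))//; first by rewrite ler_pM2r// lerDl.
rewrite mulrC -ler_pdivlMr//.
by rewrite /eps ge_min lexx orbT.
Qed.

End Approx.

End NewtonApprox.

(** * Real powers *)

Section Powers.
Variable R : realType.

(** The [k]-th derivative of [x^t] for positive [x]. *)
Definition powd (t : R) k (x : R) := (\prod_(j < k) (t - j%:R)) * x `^ (t - k%:R).

Lemma powd0 t x : powd t 0 x = x `^ t.
Proof. by rewrite /powd big_ord0 mul1r subr0. Qed.

Lemma is_derive_powd t k (y : R) : 0 < y ->
  is_derive y 1 (powd t k) (powd t k.+1 y).
Proof.
move=> y0; have dP := is_derive1_powR (t - k%:R) y0.
have := @is_deriveZ _ _ _ _ (\prod_(j < k) (t - j%:R)) _ _ _ dP.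
rewrite /powd big_ord_recr/= -natr1 opprD addrA -mulrA.
exact.
Qed.

Lemma powd_ge0 t n k (y : R) : n%:R <= t + 1 -> (k <= n)%N -> 0 <= powd t k y.
Proof.
move=> nt kn; rewrite mulr_ge0 ?powR_ge0// prodr_ge0// => j _.
rewrite subr_ge0 -(lerD2r 1) natr1 (le_trans _ nt)// ler_nat.
exact: leq_trans (ltn_ord j) kn.
Qed.

(** The power is monotone in a direction set by the sign of [e]; the sum of both end values covers
    either case. *)
Lemma powR_bound (e a b y : R) : 0 < a -> a <= y -> y <= b ->
  y `^ e <= a `^ e + b `^ e.
Proof.
move=> a0 ay yb; have y0 := lt_le_trans a0 ay; have b0 := lt_le_trans y0 yb.
have [e0|e0] := leP 0 e.
  by rewrite ler_wpDl ?powR_ge0// ge0_ler_powR// nnegrE ltW.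
rewrite ler_wpDr ?powR_ge0//.
have [r r0 ->] : exists2 r, 0 <= r & e = - r.
  by exists (- e); rewrite ?opprK ?oppr_ge0 ?ltW.
by rewrite !powRN lef_pV2 ?posrE ?powR_gt0// ge0_ler_powR// nnegrE ltW.
Qed.

Lemma powd_bound t n (a : R) : 0 < a -> forall b, exists C, forall k y,
  (k <= n)%N -> a <= y -> y <= b -> `|powd t k y| <= C.
Proof.
move=> a0 b; pose c k : R := `|\prod_(j < k) (t - j%:R)| *
  (a `^ (t - k%:R) + b `^ (t - k%:R)).
exists (\sum_(k < n.+1) c k) => k y kn ay yb.
have ck : `|powd t k y| <= c k.
  by rewrite normrM (ger0_norm (powR_ge0 _ _)) ler_wpM2l// powR_bound.
apply: (le_trans ck); rewrite (bigD1 (Ordinal (kn : (k < n.+1)%N)))//=.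
by rewrite lerDl sumr_ge0// => i _; rewrite mulr_ge0// addr_ge0// powR_ge0.
Qed.

Lemma nodesP n (d : 'rV[R]_n) x : reflect (exists i, x = d 0 i) (x \in nodes d).
Proof.
by apply: (iffP mapP) => [[i _ ->]|[i ->]]; exists i; rewrite ?mem_enum.
Qed.

(** A Newton cone polynomial close to [x^t] on the spectrum is nonnegative at [A]. The bound on [t]
    is the matrix size minus 2. *)
Lemma pow_nnmx_posdef n (A U : 'M[R]_n.+1) d t : spectral_decomp A U d ->
  sorted <=%R (nodes d) -> nnmx A -> (forall k, 0 < d 0 k) -> n%:R <= t + 1 ->
  nnmx (U *m diag_mx (map_mx (fun x => x `^ t) d) *m U^T).
Proof.
move=> dec sd A0 d0 nt i j; apply/ler_addgt0Pr => e e0.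
rewrite spectral_entry; pose W := \sum_k `|U i k * U j k|.
have W0 : 0 <= W by rewrite sumr_ge0.
have W1 : 0 < W + 1 by rewrite ltr_wpDl.
have [p pd pE] : exists2 p, ncone (nodes d) p &
    forall y, y \in nodes d -> `|p.[y] - powd t 0 y| <= e / (W + 1).
  apply: (@newton_approx _ n (powd t) (d 0 0)) => //.
  - by move=> k y; exact: is_derive_powd.
  - by move=> k y kn _; exact: powd_ge0 nt kn.
  - exact: powd_bound.
  - by rewrite size_nodes.
  - by apply/allP => y /nodesP[k ->]; exact: sorted_nodes.
  - by rewrite divr_gt0.
have := @ncone_horner _ _ _ A 1%:M _ _ pd.
rewrite mulmx1 => /(_ _ i j).
rewrite (spectral_decomp_horner _ dec) spectral_entry => pA.
apply: (le_trans (pA _)).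
  by move=> k; rewrite mulmx1; exact: micchelli_willoughby dec sd A0 k.
rewrite -lerBlDl -sumrB (@le_trans _ _ (W * (e / (W + 1))))//.
  rewrite mulr_suml ler_sum// => k _; rewrite -mulrBr (le_trans (ler_norm _))//.
  by rewrite normrM ler_wpM2l// -powd0 pE//; apply/nodesP; exists k.
by rewrite mulrCA ger_pMr// ler_pdivrMr// mul1r lerDl.
Qed.

(** At [d = 0], [e^t <= e] because [e <= 1 <= t]; for [d > 0] the derivative on [[d, d + 1]] is at
    most [t (d + 1)^(t - 1)]. *)
Lemma powR_shift_lipschitz (d t : R) : 0 <= d -> 1 <= t ->
  exists2 L, 0 <= L & forall e, 0 < e -> e <= 1 ->
    `|(d + e) `^ t - d `^ t| <= L * e.
Proof.
move=> d_ge0 t1; have t0 := lt_le_trans ltr01 t1.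
have [d0|d0] := eqVneq d 0.
  exists 1 => // e e0 e1; rewrite d0 add0r powR0 ?gt_eqF// subr0.
  by rewrite ger0_norm ?powR_ge0// mul1r ge1r_powR// e0.
have {d_ge0}d0 : 0 < d by rewrite lt_def d0.
exists (t * (d + 1) `^ (t - 1)); first by rewrite mulr_ge0 ?powR_ge0// ltW.
move=> e e0 e1.
have [|z [dz ze]] := @dds_mvt _ 1 (powd t) d [:: d + e]
  (fun k y => @is_derive_powd t k y) d0 _ erefl.
  by rewrite /= ltrDl e0.
rewrite /= mulr1 !powd0 addrAC subrr add0r => dE.
have -> : (d + e) `^ t - d `^ t = powd t 1 z * e.
  by rewrite -dE divfK// gt_eqF.
have z0 := lt_le_trans d0 dz.
rewrite normrM (gtr0_norm e0) ler_wpM2r ?(ltW e0)//.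
rewrite /powd big_ord_recl big_ord0 mulr1 subr0 normrM gtr0_norm//.
rewrite ler_wpM2l ?(ltW t0)// ger0_norm ?powR_ge0// ge0_ler_powR ?subr_ge0//.
- by rewrite nnegrE ltW.
- by rewrite nnegrE addr_ge0// ltW.
- by rewrite (le_trans ze)// lerD2l.
Qed.

(** [A + h I] has the same eigenvectors and positive eigenvalues, and each entry of its power is
    within a multiple of [h] of the original. *)
Lemma pow_nnmx n (A U : 'M[R]_n.+1) d t : spectral_decomp A U d ->
  nnmx A -> (forall k, 0 <= d 0 k) -> 1 <= t -> n%:R <= t + 1 ->
  nnmx (U *m diag_mx (map_mx (fun x => x `^ t) d) *m U^T).
Proof.
move=> dec0 A0 d0 t1 nt i j.
pose L k := projT1 (cid2 (powR_shift_lipschitz (d0 k) t1)).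
have LP k : 0 <= L k /\ forall e, 0 < e -> e <= 1 ->
    `|(d 0 k + e) `^ t - d 0 k `^ t| <= L k * e.
  by rewrite /L; case: cid2.
apply/ler_addgt0Pr => e e0; rewrite spectral_entry.
pose W := \sum_k `|U i k * U j k| * L k.
have W0 : 0 <= W by rewrite sumr_ge0// => k _; rewrite mulr_ge0// (LP k).1.
have W1 : 0 < W + 1 by rewrite ltr_wpDl.
pose h := Num.min 1 (e / (W + 1)).
have h0 : 0 < h by rewrite lt_min ltr01 divr_gt0.
have h1 : h <= 1 by rewrite ge_min lexx.
have dec : spectral_decomp (A + h%:M) U (d + const_mx h).
  have [UU AE] := dec0; split => //.
  rewrite linearD/= diag_const_mx mulmxDr mulmxDl -AE; congr (_ + _).
  by rewrite scalar_mxC -mulmxA (spectral_decompC dec0) mulmx1.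
have [V [f [decV sf fd fE]]] := spectral_decomp_sorted dec.
have : nnmx (V *m diag_mx (map_mx (fun x => x `^ t) f) *m V^T).
  apply: (pow_nnmx_posdef decV) => // [x y|k].
    by rewrite !mxE addr_ge0// mulrn_wge0// ltW.
  by have [l ->] := fd k; rewrite !mxE ltr_wpDl.
move=> /(_ i j); rewrite -fE spectral_entry => /le_trans; apply.
rewrite -lerBlDl -sumrB (@le_trans _ _ (W * h))//.
  rewrite mulr_suml ler_sum// => k _; rewrite -mulrBr (le_trans (ler_norm _))//.
  by rewrite normrM -mulrA ler_wpM2l// !mxE (LP k).2.
rewrite (@le_trans _ _ (W * (e / (W + 1))))//.
  by rewrite ler_wpM2l// ge_min lexx orbT.
by rewrite mulrCA ger_pMr// ler_pdivrMr// mul1r lerDl.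
Qed.

Lemma spectral_decomp_eigen n (A U : 'M[R]_n) d k : spectral_decomp A U d ->
  ((col k U)^T *m A *m col k U) 0 0 = d 0 k.
Proof.
move=> [UU ->]; rewrite colE trmx_mul trmx_delta -!mulmxA.
rewrite (mulmxA U^T U) UU mul1mx (mulmxA U^T U) UU mul1mx mulmxA.
by rewrite -rowE -colE !mxE eqxx.
Qed.

Lemma psd_spectral_ge0 n (A U : 'M[R]_n) d : psd A -> spectral_decomp A U d ->
  forall k, 0 <= d 0 k.
Proof. by move=> [_ A0] dec k; rewrite -(spectral_decomp_eigen k dec). Qed.

Lemma spectral_psd n (U : 'M[R]_n) (d : 'rV[R]_n) : (forall k, 0 <= d 0 k) ->
  psd (U *m diag_mx d *m U^T).
Proof.
move=> d0; split; first by rewrite !trmx_mul trmxK tr_diag_mx mulmxA.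
move=> x; rewrite !mulmxA -(mulmxA _ U^T).
have -> : x^T *m U = (U^T *m x)^T by rewrite trmx_mul trmxK.
rewrite mxE sumr_ge0// => k _; rewrite mul_mx_diag !mxE mulrAC.
by rewrite mulr_ge0// -expr2 sqr_ge0.
Qed.

Lemma power_dnn_from_size n : (2 <= n)%N -> power_dnn_from n.+1 (n%:R - 1 : R).
Proof.
move=> n2 t _ nt A dnnA; rewrite /mpow; case: pselect => // h.
case: (cid h) => -[U d] /= dec.
have [_ [psdA A0]] := dnnA; have d0 := psd_spectral_ge0 psdA dec.
have [psym ppsd] : psd (U *m diag_mx (map_mx (fun x => x `^ t) d) *m U^T).
  by apply: spectral_psd => k; rewrite mxE powR_ge0.
split => //; split => //; apply: (pow_nnmx dec) => //.
  (* [2 <= n] yields [1 <= t], which the shift at zero eigenvalues requires. *)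
  rewrite (le_trans _ nt)// lerBrDr (_ : 1 + 1 = 2%:R)// ler_nat//.
by rewrite -lerBlDr.
Qed.

(** Each factor [A] raises the index by at most 1, so for [m <= l] the entry of [A ^+ m] at [(0, l)]
    is 1 if [m = l] and 0 otherwise. *)
Lemma superdiag_horner n (A : 'M[R]_n.+1) (q : {poly R}) (k : 'I_n.+1) :
  (forall i j : 'I_n.+1, (i.+1 < j)%N -> A i j = 0) ->
  (forall i j : 'I_n.+1, i.+1 = j -> A i j = 1) ->
  (size q <= k.+1)%N -> horner_mx A q 0 k = q`_k.
Proof.
move=> A0 A1 sq.
have AX m (l : 'I_n.+1) : (m <= l)%N -> (A ^+ m) 0 l = (m == l)%:R.
  elim: m l => [|m IHm] l ml; first by rewrite expr0 mxE -val_eqE.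
  have lS : (l.-1.+1 = l)%N by rewrite prednK// (leq_trans _ ml).
  have l1 : (l.-1 < n.+1)%N by rewrite lS ltnW.
  have ml1 : (m <= l.-1)%N by rewrite -ltnS lS.
  rewrite exprSr mxE (bigD1 (Ordinal l1))//= IHm// A1// mulr1 -eqSS lS.
  rewrite big1 ?addr0// => i il; have [il1|il1] := ltnP i l.-1.
    by rewrite A0 ?mulr0// -lS ltnS.
  have {il il1} il : (l.-1 < i)%N by rewrite ltn_neqAle il1 andbT eq_sym.
  have mi : (m < i)%N by exact: leq_ltn_trans il.
  by rewrite IHm 1?ltnW// ltn_eqF// mul0r.
rewrite -{1}[q]coefK poly_def rmorph_sum summxE/=.
under eq_bigr => m _.
  rewrite linearZ/= rmorphXn/= horner_mx_X mxE AX; last first.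
    by rewrite -ltnS (leq_trans _ sq).
  over.
have [kq|kq] := ltnP k (size q).
  rewrite (bigD1 (Ordinal kq))//= eqxx mulr1 big1 ?addr0// => m mk.
  by rewrite -[_ == _]/(m == Ordinal kq) (negPf mk) mulr0.
rewrite nth_default// big1// => m _.
by rewrite ltn_eqF ?mulr0// (leq_trans _ kq).
Qed.

(* The corner entry of the Newton interpolant of x^t at A is its leading
   coefficient, a divided difference, hence a derivative of x^t up to a positive
   factor. *)
Lemma superdiag_pow_lt0 n (A U : 'M[R]_n.+1) d t :
  (forall i j : 'I_n.+1, (i.+1 < j)%N -> A i j = 0) ->
  (forall i j : 'I_n.+1, i.+1 = j -> A i j = 1) ->
  spectral_decomp A U d -> (forall k, 0 < d 0 k) ->
  \prod_(j < n) (t - j%:R) < 0 ->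
  (U *m diag_mx (map_mx (fun x => x `^ t) d) *m U^T) 0 ord_max < 0.
Proof.
move=> A0 A1 dec0 d0 t0.
have [V [e [dec se ed ->]]] := spectral_decomp_sorted dec0.
have e0 k : 0 < e 0 k by have [l ->] := ed k.
(* With a repeated eigenvalue, the product [q] over the distinct ones would be monic of degree at
   most [n] and annihilate [A], yet [q(A)] has entry 1 in row 0 and column [size s]. *)
have ue : uniq (nodes e).
  pose s := undup (nodes e); pose q := \prod_(x <- s) ('X - x%:P).
  have sn : (size s <= n.+1)%N by rewrite -(size_nodes e) size_undup.
  have qA : horner_mx A q = 0.
    rewrite (spectral_decomp_horner _ dec).
    have -> : map_mx (horner q) e = 0.
      apply/rowP => k; rewrite !mxE; apply/rootP; rewrite root_prod_XsubC.
      by rewrite mem_undup; apply/nodesP; exists k.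
    by rewrite linear0 mulmx0 mul0mx.
  have [sn'|] := ltnP (size s) n.+1; last first.
    by rewrite -{1}(size_nodes e) leqNgt ltn_size_undup negbK.
  have := @superdiag_horner n A q (Ordinal sn') A0 A1.
  rewrite size_prod_XsubC => /(_ (leqnn _)); rewrite qA mxE/= => /eqP.
  have /monicP : q \is monic by exact: monic_prod_XsubC.
  rewrite lead_coefE size_prod_XsubC/= => ->.
  by rewrite eq_sym oner_eq0.
pose c := dds (fun x => x `^ t) (nodes e); pose p := newp (nodes e) c.
have -> : V *m diag_mx (map_mx (fun x => x `^ t) e) *m V^T = horner_mx A p.
  rewrite (spectral_decomp_horner _ dec); congr (_ *m diag_mx _ *m _).
  by apply/rowP => k; rewrite !mxE newp_dds//; apply/nodesP; exists k.
rewrite superdiag_horner//; last by rewrite (leq_trans (size_newp _ _)) ?size_nodes.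
rewrite (@coef_newp _ n) ?size_dds ?size_nodes//.
have : sorted <%R (nodes e) by rewrite lt_sorted_uniq_le ue.
have : all (> 0) (nodes e) by apply/allP => x /nodesP[k ->].
rewrite /c; have := size_nodes e; case: (nodes e) => [//|x s] [ss] /andP[x0 _] xs.
have [z [xz _ zE]] := dds_mvt (fun k y => @is_derive_powd t k y) x0 xs ss.
have fE : powd t 0 = (fun x => x `^ t) by apply/funext => y; rewrite powd0.
rewrite fE in zE; rewrite -(pmulr_llt0 _ (_ : 0 < n`!%:R)) ?ltr0n ?fact_gt0//.
by rewrite zE /powd pmulr_llt0// powR_gt0// (lt_le_trans x0).
Qed.

End Powers.

(** * A tridiagonal counterexample for exponents between 2 and 3 *)

Section Path.
Variable R : realType.

(** The adjacency matrix of the path on 5 vertices plus [3 I]; the shift makes every eigenvalue at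
    least 1. *)
Definition pathmx : 'M[R]_5 :=
  \matrix_(i, j) if i == j then 3 else ((i.+1 == j) || (j.+1 == i))%:R.

Lemma pathmx_sym : pathmx^T = pathmx.
Proof. by apply/matrixP => i j; rewrite !mxE eq_sym orbC. Qed.

(** The difference is a sum of squares: those of the two end coordinates and of the sums of
    neighbours. *)
Lemma pathmx_quad (x : 'cV[R]_5) :
  (x^T *m x) 0 0 <= (x^T *m pathmx *m x) 0 0.
Proof.
pose y k := x (inord k) 0.
have xy (i : 'I_5) : x i 0 = y i by rewrite /y inord_val.
have -> : (x^T *m x) 0 0 = \sum_(i < 5) y i * y i.
  by rewrite mxE; apply: eq_bigr => i _; rewrite mxE xy.
have -> : (x^T *m pathmx *m x) 0 0 = \sum_(j < 5) (\sum_(i < 5)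
    y i * (if (i == j :> nat) then 3 else ((i.+1 == j) || (j.+1 == i))%:R)) * y j.
  rewrite mxE; apply: eq_bigr => j _; rewrite mxE xy; congr (_ * _).
  by apply: eq_bigr => i _; rewrite !mxE xy.
rewrite !big_ord_recr !big_ord0 /=.
move: (y 0%N) (y 1%N) (y 2) (y 3) (y 4) => a b c d e.
rewrite -subr_ge0; set q := (X in 0 <= X).
have -> : q = a ^+ 2 + (a + b) ^+ 2 + (b + c) ^+ 2 + (c + d) ^+ 2 +
  (d + e) ^+ 2 + e ^+ 2 by rewrite /q; ring.
by rewrite !addr_ge0 ?sqr_ge0.
Qed.

Lemma pathmx_dnn : dnn pathmx.
Proof.
split; first exact: pathmx_sym.
split; last by move=> i j; rewrite mxE; case: ifP; rewrite // ler0n.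
split; first exact: pathmx_sym.
move=> x; rewrite (le_trans _ (pathmx_quad x))// mxE sumr_ge0// => k _.
by rewrite mxE -expr2 sqr_ge0.
Qed.

Lemma pathmx_spectral_gt0 U d : spectral_decomp pathmx U d ->
  forall k, 0 < d 0 k.
Proof.
move=> dec k; rewrite -(spectral_decomp_eigen k dec).
rewrite (lt_le_trans _ (pathmx_quad _))// colE trmx_mul trmx_delta -mulmxA.
have [UU _] := dec.
by rewrite (mulmxA U^T) UU mul1mx mul_delta_mx mxE !eqxx ltr01.
Qed.

Lemma pathmx_pow_not_dnn t : 2 < t -> t < 3 -> ~ dnn (mpow pathmx t).
Proof.
move=> t2 t3; rewrite /mpow; case: pselect => [h|]; last first.
  case; have [U [d dec]] := sym_spectral_decomp pathmx_sym.
  by exists (U, d).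
case: (cid h) => -[U d] /= dec [_ [_ /(_ 0 ord_max)]].
apply/negP; rewrite -ltNge; apply: (superdiag_pow_lt0 _ _ (dec)).
- move=> i j ij; have lt_ij : (i < j)%N := ltnW ij.
  rewrite mxE -val_eqE/= (ltn_eqF lt_ij) (ltn_eqF ij) gtn_eqF//.
  by rewrite ltnS ltnW.
- by move=> i j ij; rewrite mxE -val_eqE /= -ij ltn_eqF// eqxx.
- exact: pathmx_spectral_gt0 dec.
rewrite !big_ord_recr big_ord0/= mul1r subr0.
have -> : t * (t - 1) * (t - 2) * (t - 3) = - ((t * (t - 1) * (t - 2)) * (3 - t)).
  by ring.
by rewrite oppr_lt0 !mulr_gt0//; lra.
Qed.

End Path.

Theorem theorem4p1 (R : realType) : is_critical_exponent 5 (3 : R).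
Proof.
split.
  by have := @power_dnn_from_size R 4 isT; rewrite (_ : 4%:R - 1 = 3)//; lra.
move=> m hm; rewrite leNgt; apply/negP => m3.
(* Any point of the interval from 2 to 3 could replace [5 / 2]; the maximum keeps [t] above [m] and
   below 3. *)
pose t := Num.max m (5 / 2).
have t2 : 2 < t by rewrite lt_max; apply/orP; right; lra.
have t3 : t < 3 by rewrite gt_max m3; lra.
apply: (@pathmx_pow_not_dnn R t) => //; apply: hm.
- by lra.
- by rewrite le_max lexx.
- exact: pathmx_dnn.
Qed.
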